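(* Consider a D1-brane in a flat background with one transverse scalar $Y(x)$ and a static worldvolume electric field $\tilde{E}(x)$, $x\in\mathbb{R}$, where $Y$ and $\tilde E$ are smooth real functions with $\tilde{E}^2<1+Y'^2$. Suppose the equations of motion hold, i.e. there are constants $Q_Y,Q_F\in\mathbb{R}$ with $$\frac{Y'}{\sqrt{1+Y'^2-\tilde{E}^2}}=e^{\phi}Q_Y,\qquad -\frac{\tilde{E}}{\sqrt{1+Y'^2-\tilde{E}^2}}=e^{\phi}Q_F ,$$ and suppose that the stress tensor vanishes pointwise, i.e. with $2C_{01}=e^{-\phi}$, $$0=2C_{01}-e^{-\phi}\,\frac{1+Y'^2-2\tilde{E}^2}{(1+Y'^2-\tilde{E}^2)^{3/2}}\qquad\text{for all }x .$$ Then the configuration is trivial: $\tilde{E}\equiv 0$ and $Y'\equiv 0$. That is, there are no (nontrivial) BPS solitons on the D1-brane worldvolume.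
   Context: $\tilde{E}=2\pi\alpha' F_{01}$ is the rescaled electric field on the brane, $Y'=dY/dx$, $\phi$ is the real-valued background dilaton (no backreaction of the probe is considered), and $C_{01}$ is the Ramond-Ramond two-form potential along the brane, normalized so that the trivial configuration has zero energy. The Dirac-Born-Infeld Lagrangian density is proportional to $-e^{-\phi}\sqrt{1+Y'^2-\tilde{E}^2}$, and the displayed stress-tensor expression is (up to a positive overall constant) the single spatial component of the stress tensor obtained from the corresponding energy. Here a BPS soliton means a nontrivial static solution of the equations of motion for which this stress tensor component vanishes identically. *)

(* Defs.v *)
(* Stdlib real numbers with Coquelicot's total derivative. *)
From Stdlib Require Import Reals.
From Coquelicot Require Import Coquelicot.
Open Scope R_scope.

(* Static fields are functions of the single spatial worldvolume coordinate:
   [Y] is the transverse scalar, [E] the rescaled electric field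
   2 pi alpha' F_01, [phi] and [C01] the values along the brane of the dilaton
   and of the Ramond-Ramond two-form potential. *)

Definition smooth (f : R -> R) : Prop :=
  forall (n : nat) (x : R), ex_derive_n f n x.

(* The expression under the square root of the Dirac-Born-Infeld Lagrangian
   density - e^{-phi} sqrt (1 + Y'^2 - E^2). *)
Definition dbi_radicand (Y E : R -> R) (x : R) : R :=
  1 + (Derive Y x) ^ 2 - (E x) ^ 2.

Definition admissible (Y E : R -> R) : Prop :=
  smooth Y /\ smooth E /\ forall x : R, (E x) ^ 2 < 1 + (Derive Y x) ^ 2.

(* First integrals of the static field equations: the momenta conjugate to Y'
   and to the electric field are constant; Q_Y and Q_F do not depend on x. *)
Definition equations_of_motion (phi Y E : R -> R) : Prop :=
  exists Q_Y Q_F : R, forall x : R,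
    Derive Y x / sqrt (dbi_radicand Y E x) = exp (phi x) * Q_Y /\
    - (E x / sqrt (dbi_radicand Y E x)) = exp (phi x) * Q_F.

(* The single spatial component, up to a positive overall constant. *)
Definition stress_tensor (phi C01 Y E : R -> R) (x : R) : R :=
  2 * C01 x
  - exp (- phi x) *
    ((1 + (Derive Y x) ^ 2 - 2 * (E x) ^ 2)
     / Rpower (dbi_radicand Y E x) (3 / 2)).

Definition trivial_configuration (Y E : R -> R) : Prop :=
  (forall x : R, E x = 0) /\ (forall x : R, Derive Y x = 0).

Definition BPS_soliton (phi C01 Y E : R -> R) : Prop :=
  admissible Y E /\
  equations_of_motion phi Y E /\
  (forall x : R, stress_tensor phi C01 Y E x = 0) /\
  ~ trivial_configuration Y E.

(* Main.v *)
(* With s = sqrt (1 + Y'^2 - E^2), the vanishing of the stress tensor reads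
   s^2 - E^2 = s^3, so E^2 = s^2 (1 - s) and Y'^2 = (1 - s) (s^2 - s - 1).
   The first forces 0 < s <= 1, where s^2 - s - 1 < 0, so the second forces
   s = 1, whence E = Y' = 0.  The argument is pointwise. *)

Require Import Defs.
From Stdlib Require Import Reals Lra.
From Coquelicot Require Import Coquelicot.
Open Scope R_scope.

(** Trades the real exponent for an integer one, so that the stress condition becomes polynomial in
    the square root. *)
Lemma Rpower_3_2 (d : R) : 0 < d -> Rpower d (3 / 2) = sqrt d ^ 3.
Proof.
  intros Hd.
  rewrite <- (Rpower_pow 3 (sqrt d) (sqrt_lt_R0 d Hd)), <- (Rpower_sqrt d Hd).
  rewrite Rpower_mult.
  f_equal; simpl; lra.
Qed.

Lemma stress_free_rigidity (p e s : R) :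
  0 < s -> s ^ 2 = 1 + p ^ 2 - e ^ 2 -> s ^ 2 - e ^ 2 = s ^ 3 ->
  e = 0 /\ p = 0.
Proof.
  intros Hs HD HT.
  assert (He : e ^ 2 = s ^ 2 * (1 - s)) by lra.
  assert (Hp : p ^ 2 = (1 - s) * (s ^ 2 - s - 1)).
  (* Eliminating [e] gives a cubic in [s] with root [s = 1]. *)
  { replace ((1 - s) * (s ^ 2 - s - 1)) with (2 * s ^ 2 - s ^ 3 - 1) by ring.
    lra. }
  pose proof (pow2_ge_0 e) as He0.
  pose proof (pow2_ge_0 p) as Hp0.
  assert (Hs2 : 0 < s ^ 2) by (apply pow_lt; exact Hs).
  assert (Hle : s <= 1) by nra.
  (* On [0 < s <= 1] the quadratic factor is [s * (s - 1) - 1 <= -1]. *)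
  assert (Hs1 : s = 1) by nra.
  rewrite Hs1 in He, Hp.
  split; nra.
Qed.

Theorem mainTheorem3 (phi C01 : R -> R)
  (hC : forall x : R, 2 * C01 x = exp (- phi x)) :
  (forall Y E : R -> R,
      admissible Y E ->
      equations_of_motion phi Y E ->
      (forall x : R, stress_tensor phi C01 Y E x = 0) ->
      trivial_configuration Y E) /\
  ~ (exists Y E : R -> R, BPS_soliton phi C01 Y E).
Proof.
  assert (Htriv : forall Y E : R -> R,
      admissible Y E ->
      (forall x : R, stress_tensor phi C01 Y E x = 0) ->
      trivial_configuration Y E).
  { intros Y E (_ & _ & Hadm) HT.
    assert (Hpt : forall x, E x = 0 /\ Derive Y x = 0).
    { intros x.
      specialize (HT x).
      unfold stress_tensor in HT.
      rewrite hC in HT.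
      assert (HD : 0 < dbi_radicand Y E x).
      { unfold dbi_radicand; specialize (Hadm x); lra. }
      pose proof (sqrt_lt_R0 _ HD) as Hs.
      pose proof (pow2_sqrt _ (Rlt_le _ _ HD)) as Hs2.
      rewrite (Rpower_3_2 _ HD) in HT.
      set (s := sqrt (dbi_radicand Y E x)) in *.
      unfold dbi_radicand in Hs2.
      assert (Hs3 : 0 < s ^ 3) by (apply pow_lt; exact Hs).
      pose proof (exp_pos (- phi x)) as Hexp.
      set (q := (1 + Derive Y x ^ 2 - 2 * E x ^ 2) / s ^ 3) in HT.
      (* [HT] is [exp (- phi x) * (1 - q) = 0] up to rearrangement, and the exponential is
         positive. *)
      assert (Hq : q = 1) by nra.
      assert (Hnum : 1 + Derive Y x ^ 2 - 2 * E x ^ 2 = q * s ^ 3).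
      { unfold q; field; lra. }
      rewrite Hq in Hnum.
      (* By [Hs2] the numerator in [Hnum] is [s ^ 2 - E x ^ 2]. *)
      apply (stress_free_rigidity _ _ s); lra. }
    split; intros x; apply Hpt. }
  split.
  - intros Y E Hadm _ HT; exact (Htriv Y E Hadm HT).
  - intros (Y & E & Hadm & _ & HT & Hnt); exact (Hnt (Htriv Y E Hadm HT)).
Qed.
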